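(* Let $(Y(0),Y(1),\tilde U,X,Z)$ be random variables as described in the context, and suppose Assumption 1 holds. Then for every (measurable) encouragement rule $\boldsymbol{\alpha}:\mathcal{X}\times\mathcal{Z}\to\mathbb{R}$, \[ W(\boldsymbol{\alpha})=E[Y]+E\Big[\int_0^1 \operatorname{MTE}(u,X)\,\big(1\{p(X,\boldsymbol{\alpha}(X,Z))\geq u\}-1\{p(X,Z)\geq u\}\big)\,du\Big]. \]
   Context: Setup: $D\in\{0,1\}$ is a binary treatment; $(Y(0),Y(1))$ are real-valued potential outcomes and $Y=Y(1)D+Y(0)(1-D)$; $X\in\mathcal{X}\subset\mathbb{R}^{d_x}$ are covariates; $Z\in\mathcal{Z}\subset\mathbb{R}$ is an instrument. For each $z\in\mathbb{R}$ the potential treatment is $D(z)=1\{\tilde\nu(X,z)-\tilde U\geq 0\}$ for an unknown function $\tilde\nu$ and an unobserved scalar $\tilde U$, and the observed treatment is $D=D(Z)$. Assumption 1: (i) $\tilde U$ is independent of $Z$ conditional on $X$; (ii) $E[Y(d)\mid X,Z,\tilde U]=E[Y(d)\mid X,\tilde U]$ and $E|Y(d)|<\infty$ for $d\in\{0,1\}$; (iii) $\tilde U$ is continuously distributed conditional on $X$. Define $U=F_{\tilde U|X}(\tilde U\mid X)$ and $\nu(x,z)=F_{\tilde U|X}(\tilde\nu(x,z)\mid x)$, so that $D(z)=1\{\nu(X,z)\ge U\}$ with $U\mid X,Z\sim\mathrm{Unif}[0,1]$, and the propensity score $p(x,z)=\Pr(D=1\mid X=x,Z=z)$ equals $\nu(x,z)$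 (extended to all $z\in\mathbb{R}$ via this formula). The marginal treatment effect is $\operatorname{MTE}(u,x)=E[Y(1)-Y(0)\mid U=u,X=x]$. An encouragement rule is a map $\boldsymbol{\alpha}:\mathcal{X}\times\mathcal{Z}\to\mathbb{R}$ that sets the instrument of an individual with $(X,Z)=(x,z)$ to $\boldsymbol{\alpha}(x,z)$; its social welfare is $W(\boldsymbol{\alpha})=E[Y(D(\boldsymbol{\alpha}(X,Z)))]$ where $Y(D(a))=Y(1)D(a)+Y(0)(1-D(a))$. *)

(* Defs.v *)
From mathcomp Require Import all_boot all_order all_algebra all_classical all_reals all_analysis.
Import numFieldNormedType.Exports.
Set Implicit Arguments. Unset Strict Implicit. Unset Printing Implicit Defensive.
Import Order.TTheory GRing.Theory Num.Theory.
Local Open Scope classical_set_scope.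
Local Open Scope ring_scope.

Definition covspace (R : realType) (dx : nat) := g_sigma_algebraType (@open 'rV[R]_dx).

Section Defs.
Context {d : measure_display} {Omega : measurableType d} {R : realType}
        (P : probability Omega R).

Definition is_cond_exp {dT} {T : measurableType dT}
  (V : Omega -> R) (W : Omega -> T) (g : T -> R) : Prop :=
  [/\ measurable_fun setT g,
      P.-integrable setT (EFin \o (g \o W)) &
      forall S : set T, measurable S ->
        (\int[P]_(w in W @^-1` S) (V w)%:E = \int[P]_(w in W @^-1` S) (g (W w))%:E)%E].

Definition ind (A : set Omega) (w : Omega) : R := (w \in A)%:R.

Definition cond_indep {dT} {T : measurableType dT}
  (U Z : Omega -> R) (X : Omega -> T) : Prop :=
  forall A B : set R, measurable A -> measurable B ->
    exists gA gB : T -> R,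
      [/\ is_cond_exp (ind (U @^-1` A)) X gA,
          is_cond_exp (ind (Z @^-1` B)) X gB &
          is_cond_exp (fun w => ind (U @^-1` A) w * ind (Z @^-1` B) w) X
                      (fun x => gA x * gB x)].

Definition mean_indep {dT} {T : measurableType dT}
  (V : Omega -> R) (X : Omega -> T) (Z U : Omega -> R) : Prop :=
  exists h : (T * R)%type -> R,
    is_cond_exp V (fun w => (X w, U w)) h /\
    is_cond_exp V (fun w => (X w, (Z w, U w)))
                (fun q : (T * (R * R))%type => h (q.1, q.2.2)).

Definition is_cond_cdf {dT} {T : measurableType dT}
  (U : Omega -> R) (X : Omega -> T) (F : T -> R -> R) : Prop :=
  [/\ forall x, {homo F x : s t / s <= t},
      forall x, F x t @[t --> -oo] --> (0 : R),
      forall x, F x t @[t --> +oo] --> (1 : R),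
      forall x t, F x @ t^'+ --> F x t &
      forall t, is_cond_exp (ind (U @^-1` `]-oo, t])) X (fun x => F x t)].

End Defs.

Section Model.
Context {R : realType} {dT} {T : measurableType dT}.

Definition normU {Omega} (F : T -> R -> R) (X : Omega -> T) (Ut : Omega -> R)
  (w : Omega) : R := F (X w) (Ut w).

(* nu(x,z) = F_{U~|X}(nu~(x,z) | x); the propensity score p(x,z) = nu(x,z),
   extended to all z in R via this formula. *)
Definition pscore (F : T -> R -> R) (nut : (T * R)%type -> R) (x : T) (z : R) : R :=
  F x (nut (x, z)).

Definition Dpot {Omega} (nut : (T * R)%type -> R) (X : Omega -> T) (Ut : Omega -> R)
  (z : R) (w : Omega) : R := ((0 <= nut (X w, z) - Ut w)%R)%:R.

Definition Ypot {Omega} (Y0 Y1 : Omega -> R) (Dw : R) (w : Omega) : R :=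
  Y1 w * Dw + Y0 w * (1 - Dw).

End Model.

(* Main.v *)
(* Let [Q x] be the quantile function of the conditional law [F x] of [Ut] given
   [X = x], and let [u] be uniform on [0, 1], independent of [(X, Z)].
   Conditional independence says that [(X, Z, Ut)] has the same law as
   [(X, Z, Q X u)].  Since [F x] is continuous, [F x (Q x u) = u], so every almost
   sure statement and every integral involving [U = F X Ut] can be read off the
   uniform variable [u]: [Ut = Q X U] a.s., the events [Ut <= m (X, Z)] and
   [U <= F X (m (X, Z))] agree a.s., and [U] is uniform given [(X, Z)].  The first
   fact makes [MTE (U, X)] a version of [E(Y1 - Y0 | X, Ut)], which by mean
   independence is also [E(Y1 - Y0 | X, Z, Ut)].  The change in welfare is the
   integral of [Y1 - Y0] against the change in treatment, which is a function of
   [(X, Z, Ut)]; conditioning and then integrating the uniform variable out by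
   Fubini gives the formula. *)

From HB Require Import structures.
Require Import Defs.
From mathcomp Require Import all_boot all_order all_algebra all_classical all_reals all_analysis.
From mathcomp Require Import measurable_realfun ring.
Import numFieldNormedType.Exports.
Import Order.TTheory GRing.Theory Num.Theory.
Local Open Scope classical_set_scope.
Local Open Scope ring_scope.

(** * Image measures and the uniform law *)

(* [R] carries two measurable structures with the same measurable sets but
   distinct displays: the one of [measurableTypeR R], on which [lebesgue_measure]
   and [uniform_prob] live, and the canonical one. *)
Definition canonicalR (R : realType) : measurableTypeR R -> R := id.

Lemma measurable_canonicalR (R : realType) : measurable_fun setT (canonicalR R).
Proof. exact: measurable_id. Qed.

HB.instance Definition _ (R : realType) :=
  isMeasurableFun.Build _ _ _ _ (canonicalR R) (measurable_canonicalR R).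

Definition unif01 (R : realType) : probability R R :=
  distribution (@uniform_prob R 0 1 ltr01) (canonicalR R).

(** The nonnegative case applies to the positive and negative parts separately, so integrands that
    are not integrable are covered too. *)
Lemma integral_unif01 (R : realType) (f : R -> \bar R) :
  measurable_fun setT f ->
  (\int[unif01 R]_u f u = \int[@lebesgue_measure R]_(u in `[0%R, 1%R]) f u)%E.
Proof.
have ge0 (g : R -> \bar R) : measurable_fun setT g -> (forall u, 0 <= g u)%E ->
    (\int[unif01 R]_u g u = \int[@lebesgue_measure R]_(u in `[0%R, 1%R]) g u)%E.
  move=> mg g0; rewrite ge0_integral_distribution// integral_uniform//.
  by rewrite subr0 invr1 mul1e.
move=> mf; rewrite [LHS]integralE [RHS]integralE !ge0//.
- exact: measurable_funeneg.
- exact: measurable_funepos.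
Qed.

Lemma unif01E (R : realType) (A : set R) : measurable A ->
  unif01 R A = @lebesgue_measure R (`[0%R, 1%R] `&` A).
Proof.
move=> mA; have mI : measurable (`[0%R, 1%R] `&` A).
  by apply: measurableI => //; exact: measurable_itv.
(* Both measures become integrals of the constant 1, to which [integral_unif01] applies. *)
rewrite -[LHS]mul1e -[RHS]mul1e -!integral_cst// integral_mkcond.
rewrite integral_unif01; last first.
  by apply/(measurable_restrictT _ _).1 => //; exact: measurable_cst.
by rewrite -integral_mkcondr.
Qed.

Lemma unif01_le {R : realType} {c : R} : 0 <= c <= 1 ->
  unif01 R [set u | u <= c] = c%:E.
Proof.
move=> /andP[c0 c1].
have -> : [set u : R | u <= c] = `]-oo, c]%classic.
  by apply/seteqP; split => x /=; rewrite in_itv.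
rewrite unif01E; last exact: measurable_itv.
have -> : `[0%R, 1%R] `&` `]-oo, c] = `[0, c]%classic.
  apply/seteqP; split => x /=; rewrite !in_itv/=.
    by move=> [/andP[-> _] ->].
  by move=> /andP[x0 xc]; rewrite x0 xc (le_trans xc).
rewrite lebesgue_measure_itv/= lte_fin.
by case: ltgtP c0 => [_ _|//|<- _] //; rewrite -EFinD subr0.
Qed.

(** [quantile] has its meaning only for [0 < u < 1]; what remains of [[0, 1]] is countable, hence
    null. *)
Lemma unif01_ae (R : realType) : {ae unif01 R, forall u, 0 < u < 1}.
Proof.
exists (~` `]0, 1[%classic); split.
- by apply: measurableC; exact: measurable_itv.
- rewrite unif01E; last by apply: measurableC; exact: measurable_itv.
  apply: (@countable_lebesgue_measure0 R).
  apply: (@sub_countable _ _ _ [set 0%R; 1%R]); last exact: finite_set_countable.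
  apply: subset_card_le => x [/=]; rewrite !in_itv/=.
  rewrite !le_eqVlt => /andP[/orP[/eqP <- _ _|x0]]; first by left.
  by move=> /orP[/eqP -> _|x1]; [right|rewrite x0 x1].
- by move=> u /= nu; rewrite in_itv/=.
Qed.

Lemma integral_ae_eq_set {d} {Omega : measurableType d} {R : realType}
  {P : {measure set Omega -> \bar R}} {f : Omega -> \bar R} {A B : set Omega} :
  measurable A -> measurable B -> measurable_fun setT f ->
  {ae P, forall w, A w <-> B w} ->
  (\int[P]_(w in A) f w = \int[P]_(w in B) f w)%E.
Proof.
move=> mA mB mf AB; rewrite [LHS]integral_mkcond [RHS]integral_mkcond.
apply: ae_eq_integral => //.
- by apply/(measurable_restrictT _ _).1 => //; exact: measurable_funTS.
- by apply/(measurable_restrictT _ _).1 => //; exact: measurable_funTS.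
- apply: filterS AB => w AB _; rewrite !patchE.
  by congr (if _ then _ else _); apply: asbool_equiv_eq.
Qed.

Lemma measurable_preimage {d d'} {S : measurableType d} {T : measurableType d'}
  {f : S -> T} {A : set T} :
  measurable_fun setT f -> measurable A -> measurable (f @^-1` A).
Proof. by move=> mf mA; rewrite -[X in measurable X]setTI; exact: mf. Qed.

Section ImageMeasure.
Context {d d'} {S : measurableType d} {T : measurableType d'} {R : realType}.
Context (m : {measure set S -> \bar R}) {f : S -> T}.
Hypothesis mf : measurable_fun setT f.

Definition image_measure : {measure set T -> \bar R} :=
  measure_function_pushforward__canonical__measure_function_Measure m mf.

Context {g : T -> \bar R}.
Hypothesis mg : measurable_fun setT g.

Lemma integrable_image_measure :
  m.-integrable setT (g \o f) -> image_measure.-integrable setT g.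
Proof.
by move=> ig; apply: (integrable_pushforward mf) => //; rewrite preimage_setT.
Qed.

Lemma integral_image_measure A : measurable A ->
  m.-integrable setT (g \o f) ->
  (\int[image_measure]_(y in A) g y = \int[m]_(x in f @^-1` A) g (f x))%E.
Proof.
move=> mA ig; apply: (integral_pushforward mf) => //.
by apply: (integrableS measurableT) => //; exact: measurable_preimage.
Qed.

Lemma ae_image_measure {Q : T -> Prop} :
  {ae image_measure, forall y, Q y} -> {ae m, forall x, Q (f x)}.
Proof.
move=> [N [mN N0 sN]]; exists (f @^-1` N); split => //.
- exact: measurable_preimage.
- by move=> x /= nQ; apply: sN.
Qed.

End ImageMeasure.

(** Under the image measure of [W], the defining identities say that [g1] and [g2] have equal
    integrals over all measurable sets. *)
Lemma is_cond_exp_unique {d} {Omega : measurableType d} {R : realType}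
  {P : probability Omega R} {dT} {T : measurableType dT}
  {V : Omega -> R} {W : Omega -> T} {g1 g2 : T -> R} : measurable_fun setT W ->
  is_cond_exp P V W g1 -> is_cond_exp P V W g2 ->
  {ae P, forall w, g1 (W w) = g2 (W w)}.
Proof.
move=> mW [mg1 ig1 g1E] [mg2 ig2 g2E].
have mE1 : measurable_fun setT (EFin \o g1) by exact/measurable_EFinP.
have mE2 : measurable_fun setT (EFin \o g2) by exact/measurable_EFinP.
have : ae_eq (image_measure P mW) setT (EFin \o g1) (EFin \o g2).
  apply: integral_ae_eq => //; first exact: integrable_image_measure.
  move=> E _ mE.
  by rewrite !integral_image_measure//= -g1E// -g2E.
move=> /ae_image_measure; apply: filterS => w /(_ I) e.
exact: EFin_inj e.
Qed.

(** * Pulling out known factors *)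

Lemma measurable_set_le {d} {T : measurableType d} {R : realType} {f g : T -> R} :
  measurable_fun setT f -> measurable_fun setT g ->
  measurable [set x | f x <= g x].
Proof.
move=> mf mg; rewrite -[X in measurable X]setTI.
exact: (measurable_fun_ler mf mg measurableT (Y := [set true])).
Qed.

Lemma integrable_snd {d1 d2} {S : measurableType d1} {T : measurableType d2}
  {R : realType} (m1 : probability S R) {m2 : probability T R} {f : T -> \bar R} :
  m2.-integrable setT f -> (m1 \x m2)%E.-integrable setT (fun z => f z.2).
Proof.
move=> /integrableP[mf intf]; apply/integrable12ltyP => /=.
  exact: measurableT_comp.
by rewrite integral_cst// [X in (_ * X)%E]probability_setT mule1.
Qed.

(** A number in [[0, 1]] is the uniform measure of the [u] below it. Inserting this for [psi w] and
    exchanging integrals by Fubini gives the identity; [V] dominates the integrand. *)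
Lemma integral_mul_layer_cake {d} {T : measurableType d} {R : realType}
  {P : probability T R} {psi V : T -> R} :
  measurable_fun setT psi -> (forall w, 0 <= psi w <= 1) ->
  P.-integrable setT (EFin \o V) ->
  (\int[P]_w (psi w * V w)%:E =
   \int[unif01 R]_u \int[P]_(w in [set w | (u <= psi w)%R]) (V w)%:E)%E.
Proof.
move=> mpsi psi01 iV; pose A : set (R * T) := [set z | z.1 <= psi z.2].
have mA : measurable A.
  by apply: measurable_set_le => //; exact: measurableT_comp.
pose f := (fun z : R * T => (V z.2)%:E) \_ A.
have intf : (unif01 R \x P)%E.-integrable setT f.
  apply/(integrable_mkcond _ mA).1.
  by apply: (integrableS measurableT) => //; exact: (integrable_snd (unif01 R) iV).
transitivity (\int[P]_w \int[unif01 R]_u f (u, w))%E.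
  apply: eq_integral => w _.
  have mAw : measurable [set u : R | u <= psi w] by exact: measurable_set_le.
  have -> : (fun u => f (u, w)) = (cst (V w)%:E) \_ [set u : R | u <= psi w].
    by apply/funext => u; rewrite /f !patchE; congr (if _ then _ else _); rewrite !in_setE.
  by rewrite -integral_mkcond integral_cst// [X in (_ * X)%E](unif01_le (psi01 w)) -EFinM mulrC.
rewrite -Fubini//; apply: eq_integral => u _.
rewrite [RHS]integral_mkcond; apply: eq_integral => w _.
by rewrite /f !patchE; congr (if _ then _ else _); rewrite !in_setE.
Qed.

(** By the layer cake, both sides average over [u] integrals on the sets where [u <= phi (W w)].
    These are preimages under [W], on which [V] and [g] composed with [W] have equal integrals. *)
Lemma is_cond_exp_pull_out {d} {Omega : measurableType d} {R : realType}
  {P : probability Omega R} {dT} {T : measurableType dT}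
  {V : Omega -> R} {W : Omega -> T} {g phi : T -> R} :
  measurable_fun setT W -> P.-integrable setT (EFin \o V) ->
  is_cond_exp P V W g ->
  measurable_fun setT phi -> (forall x, 0 <= phi x <= 1) ->
  (\int[P]_w (phi (W w) * V w)%:E = \int[P]_w (phi (W w) * g (W w))%:E)%E.
Proof.
move=> mW iV [mg ig gE] mphi phi01.
have mphiW : measurable_fun setT (phi \o W) by exact: measurableT_comp.
have phiW01 w : 0 <= (phi \o W) w <= 1 by exact: phi01.
rewrite (integral_mul_layer_cake mphiW phiW01 iV).
rewrite (integral_mul_layer_cake mphiW phiW01 ig).
apply: eq_integral => u _; apply: (gE [set x | u <= phi x]).
exact: measurable_set_le.
Qed.

(** * Quantile functions *)

(** Generalized inverse. Outside the open unit interval the set may be empty or unbounded below; the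
    default 0 keeps the sublevel sets explicit. *)
Definition quantile {R : realType} (G : R -> R) (u : R) : R :=
  if 0 < u < 1 then inf [set t | u <= G t] else 0.

Section Quantile.
Context {R : realType} {G : R -> R}.
Hypothesis ndG : {homo G : s t / s <= t}.
Hypothesis G0 : G t @[t --> -oo] --> (0 : R).
Hypothesis G1 : G t @[t --> +oo] --> (1 : R).
Hypothesis cG : continuous G.

Lemma cdf01 t : 0 <= G t <= 1.
Proof.
apply/andP; split.
- rewrite leNgt; apply/negP => Gt0.
  have [M [_ HM]] := cvgr_gt _ G0 _ Gt0.
  (* Left of [M] the limit forces [G] above [G t], while left of [t] monotonicity keeps it at most
     [G t]; this point lies in both ranges. *)
  have /HM : Num.min (M - 1) t < M by rewrite gt_min ltrBlDr ltrDl ltr01.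
  by rewrite ltNge ndG// ge_min lexx orbT.
- rewrite leNgt; apply/negP => Gt1.
  have [M [_ HM]] := cvgr_lt _ G1 _ Gt1.
  have /HM : M < Num.max (M + 1) t by rewrite lt_max ltrDl ltr01.
  by rewrite ltNge ndG// le_max lexx orbT.
Qed.

(** The infimum is attained: were [G] below [u] there, continuity would keep it below [u] slightly
    to the right, where the set has a point. *)
Lemma quantile_le (u t : R) : 0 < u < 1 -> (quantile G u <= t) = (u <= G t).
Proof.
move=> u01; rewrite /quantile u01; case/andP: u01 => u0 u1.
set S := [set s | u <= G s].
have S0 : S !=set0.
  have [M [_ HM]] := cvgr_gt _ G1 _ u1; exists (M + 1).
  by apply/ltW/HM; rewrite ltrDl.
have Slb : has_lbound S.
  have [M [_ HM]] := cvgr_lt _ G0 _ u0; exists (M - 1) => s Ss.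
  rewrite leNgt; apply/negP => sM.
  have := HM (M - 1); rewrite ltrBlDr ltrDl ltr01 => /(_ isT).
  by rewrite ltNge (le_trans Ss)// ndG// ltW.
apply/idP/idP => [St|uGt]; last exact: ge_inf.
apply: le_trans (ndG _ _ St).
rewrite leNgt; apply/negP => Gu.
have [e /= e0 He] := (nbhs_ballP _ _).1 (cvgr_lt _ (cG (inf S)) _ Gu).
have [s Ss sS] := inf_adherent e0 (conj S0 Slb).
have : G s < u.
  apply: He; rewrite /ball/= ltr_distlC sS andbT.
  by rewrite (lt_le_trans _ (ge_inf Slb Ss))// ltrBlDr ltrDl.
by rewrite ltNge => /negP; apply; exact: Ss.
Qed.

(** If [G] exceeded [u] at the quantile, continuity would keep it above [u] a little to the left,
    and [quantile_le] would place the quantile to its own left. *)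
Lemma cdf_quantile (u : R) : 0 < u < 1 -> G (quantile G u) = u.
Proof.
move=> u01; apply/eqP; rewrite eq_le -quantile_le// lexx andbT.
rewrite leNgt; apply/negP => uG.
have [e /= e0 He] := (nbhs_ballP _ _).1 (cvgr_gt _ (cG (quantile G u)) _ uG).
have : quantile G u <= quantile G u - e / 2.
  rewrite quantile_le//; apply/ltW/He.
  by rewrite /ball/= opprB addrC subrK gtr0_norm ?divr_gt0// gtr_pMr// invf_lt1// ltr1n.
by rewrite leNgt ltrBlDr ltrDl divr_gt0.
Qed.

End Quantile.

Lemma measure_ae_eq {d} {T : measurableType d} {R : realType}
  (m : {measure set T -> \bar R}) (A B : set T) :
  measurable A -> measurable B -> {ae m, forall w, A w <-> B w} -> m A = m B.
Proof.
move=> mA mB AB; rewrite -[LHS]mul1e -[RHS]mul1e -!integral_cst//.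
by apply: integral_ae_eq_set => //; exact: measurable_cst.
Qed.

Section CdfFamily.
Context {R : realType} {d} {T : measurableType d} {F : T -> R -> R}.
Hypothesis ndF : forall x, {homo F x : s t / s <= t}.
Hypothesis F0 : forall x, F x t @[t --> -oo] --> (0 : R).
Hypothesis F1 : forall x, F x t @[t --> +oo] --> (1 : R).
Hypothesis cF : forall x, continuous (F x).
Hypothesis mF : forall t, measurable_fun setT (F ^~ t).

(** By [quantile_le], each sublevel set is described by [F] at one fixed [t], so measurability in
    [x] alone yields joint measurability. *)
Lemma measurable_quantile :
  measurable_fun setT (fun z : R * T => quantile (F z.2) z.1).
Proof.
pose b t (z : R * T) := if 0 < z.1 < 1 then z.1 <= F z.2 t else 0 <= t.
have qb t z : (quantile (F z.2) z.1 <= t) = b t z.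
  by rewrite /b; case: ifPn => [/quantile_le->|/negbTE] //; rewrite /quantile => ->.
have mb t : measurable_fun setT (b t).
  apply: measurable_fun_ifT => //.
  - apply: measurable_and.
    + by apply: measurable_fun_ltr => //; exact: measurable_fst.
    + by apply: measurable_fun_ltr => //; exact: measurable_fst.
  - apply: measurable_fun_ler; first exact: measurable_fst.
    exact: (measurableT_comp (mF t) measurable_snd).
apply: (measurability _ (RGenOInfty.measurableE R)) => // _ [_ [t ->] <-].
rewrite setTI (_ : _ @^-1` _ = ~` (b t @^-1` [set true])).
  by apply: measurableC; rewrite -[X in measurable X]setTI; exact: mb.
apply/seteqP; split => z /=; rewrite in_itv/= andbT ltNge qb; first exact/negP.
by move/negP.
Qed.

Lemma unif01_quantile_le x t :
  unif01 R [set u | quantile (F x) u <= t] = (F x t)%:E.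
Proof.
rewrite -(unif01_le (cdf01 (ndF x) (F0 x) (F1 x) t)).
apply: measure_ae_eq.
- apply: measurable_set_le => //.
  exact: (measurableT_comp measurable_quantile (measurable_pair2 x)).
- exact: measurable_set_le.
- apply: filterS (@unif01_ae R) => u u01 /=.
  by rewrite (quantile_le (ndF x) (F0 x) (F1 x) (cF x)).
Qed.

(** [F x t] is the uniform measure of a section of the jointly measurable set where the quantile is
    at most [t], and measures of sections are measurable. *)
Lemma measurable_cdf : measurable_fun setT (fun z : T * R => F z.1 z.2).
Proof.
apply/measurable_EFinP.
pose A : set ((T * R) * R) := [set z | quantile (F z.1.1) z.2 <= z.1.2].
have mA : measurable A.
  apply: measurable_set_le; last exact: (measurableT_comp measurable_snd measurable_fst).
  apply: (measurableT_comp measurable_quantile (g := fun z : (T * R) * R => (z.2, z.1.1))).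
  apply: measurable_fun_pair => //.
  exact: (measurableT_comp measurable_fst measurable_fst).
have := measurable_fun_xsection (unif01 R) mA.
congr (measurable_fun _ _); apply/funext => z /=.
rewrite -unif01_quantile_le; congr (unif01 R _).
by apply/seteqP; split => u; rewrite /xsection/= inE.
Qed.

End CdfFamily.

(** * The conditional quantile transform *)

(** Boxes with a left ray in the last coordinate are the sets whose probability the conditional
    distribution function gives directly; this makes them a generator on which to compare laws. *)
Lemma measurable_prod_prod_ray {d} {T : measurableType d} {R : realType} :
  @measurable _ (T * (R * R))%type =
  <<s [set A | exists (C : set T) (B : set R) (t : R),
         [/\ measurable C, measurable B & A = C `*` (B `*` `]-oo, t])]] >>.
Proof.
set G := [set A | _]; apply/seteqP; split; last first.
  apply: smallest_sub; first exact: sigma_algebra_measurable.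
  move=> _ [C [B [t [mC mB ->]]]].
  by do 2 apply: measurableX => //; exact: measurable_itv.
have GM A : G A -> @measurable _ (g_sigma_algebraType G) A.
  exact: sub_sigma_algebra.
have GMT C B : measurable C -> measurable B ->
    @measurable _ (g_sigma_algebraType G) (C `*` (B `*` setT)).
  move=> mC mB; rewrite (_ : _ `*` _ = \bigcup_n (C `*` (B `*` `]-oo, n%:R]))).
    by apply: bigcupT_measurable => n; apply: GM; exists C, B, n%:R.
  apply/seteqP; split => [[x [z t]] /= [Cx [Bz _]]|[x [z t]] [n _ /= [? [? _]]] //].
  exists (Num.truncn `|t|).+1 => //; split => //; split => //=.
  by rewrite in_itv/= (le_trans (ler_norm _))// ltW// truncnS_gt.
(* Generation amounts to measurability of the identity out of the generated structure, which can be
   checked coordinate by coordinate. *)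
suff mid : @measurable_fun _ _ (g_sigma_algebraType G) (T * (R * R))%type setT id.
  by move=> A mA; have := mid measurableT A mA; rewrite setTI.
apply/measurable_fun_pairP; split.
  move=> _ C mC; rewrite setTI (_ : _ @^-1` C = C `*` (setT `*` setT)); first exact: GMT.
  by apply/seteqP; split => [[x [z t]]|[x [z t]] []].
apply/measurable_fun_pairP; split.
  move=> _ B mB; rewrite setTI (_ : _ @^-1` B = setT `*` (B `*` setT)); first exact: GMT.
  by apply/seteqP; split => [[x [z t]]|[x [z t]] [_ []]].
apply: (measurability _ (RGenOInfty.measurableE R)) => // _ [_ [t ->] <-].
rewrite setTI (_ : _ @^-1` _ = ~` (setT `*` (setT `*` `]-oo, t]))).
  by apply: measurableC; apply: GM; exists setT, setT, t.
apply/seteqP; split => [[x [z s]]|[x [z s]]] /=; rewrite !in_itv/= andbT ltNge.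
  by move=> /negP st [_ [_]].
by move=> nst; apply/negP => st; apply: nst.
Qed.

Section ConditionalQuantileTransform.
Context {R : realType} {d} {Omega : measurableType d} {P : probability Omega R}.
Context {dT} {T : measurableType dT}.
Context {Ut Z : Omega -> R} {X : Omega -> T} {F : T -> R -> R}.
Hypothesis mUt : measurable_fun setT Ut.
Hypothesis mZ : measurable_fun setT Z.
Hypothesis mX : measurable_fun setT X.
Hypothesis UZ : cond_indep P Ut Z X.
Hypothesis FX : is_cond_cdf P Ut X F.
Hypothesis cF : forall x, continuous (F x).

Let ndF : forall x, {homo F x : s t / s <= t}. Proof. by case: FX. Qed.
Let F0 : forall x, F x t @[t --> -oo] --> (0 : R). Proof. by case: FX. Qed.
Let F1 : forall x, F x t @[t --> +oo] --> (1 : R). Proof. by case: FX. Qed.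
Let mF : forall t, measurable_fun setT (F ^~ t).
Proof. by move=> t; case: FX => _ _ _ _ /(_ t)[]. Qed.

(** Conditional independence yields the integral of [gA * gB] over [X] in [C]. Uniqueness replaces
    [gA] by [F ^~ t], and pulling out [phi] turns [gB] back into the indicator of [Z] in [B]. *)
Lemma cond_indep_cdf (C : set T) (B : set R) t : measurable C -> measurable B ->
  P (X @^-1` C `&` Z @^-1` B `&` Ut @^-1` `]-oo, t]) =
  (\int[P]_(w in X @^-1` C `&` Z @^-1` B) (F (X w) t)%:E)%E.
Proof.
move=> mC mB; set A := `]-oo, t]%classic : set R.
have mA : measurable A by exact: measurable_itv.
have mXC := measurable_preimage mX mC; have mZB := measurable_preimage mZ mB.
have mUA := measurable_preimage mUt mA.
have [gA [gB [condA condB [mAB iAB condAB]]]] := UZ _ _ mA mB.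
have gAF : {ae P, forall w, gA (X w) = F (X w) t}.
  apply: (is_cond_exp_unique (g2 := F ^~ t) mX condA).
  by case: FX => _ _ _ _; exact.
pose phi x : R := \1_C x * F x t.
have mphi : measurable_fun setT phi by apply: measurable_funM => //; exact: measurable_indic.
have phi01 x : 0 <= phi x <= 1.
  have /andP[F_ge0 F_le1] := cdf01 (ndF x) (F0 x) (F1 x) t.
  by rewrite /phi indicE; case: (x \in C); rewrite ?mul1r ?mul0r ?lexx ?ler01 ?F_ge0.
have iB : P.-integrable setT (EFin \o (ind (Z @^-1` B) : Omega -> R)).
  exact: integrable_indic.
transitivity (\int[P]_(w in X @^-1` C) (gA (X w) * gB (X w))%:E)%E.
  rewrite -condAB// -[LHS]mul1e -integral_cst; last by do 2 apply: measurableI => //.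
  rewrite [LHS]integral_mkcond [RHS]integral_mkcond; apply: eq_integral => w _.
  rewrite !patchE /ind !in_setI; case: (w \in X @^-1` C) => //=.
  case: (w \in Z @^-1` B); case: (w \in Ut @^-1` A); by rewrite ?mulr0 ?mul0r ?mulr1.
transitivity (\int[P]_w (phi (X w) * gB (X w))%:E)%E.
  rewrite [LHS]integral_mkcond; apply: ae_eq_integral => //.
  - apply/(measurable_restrictT _ _).1 => //; apply: measurable_funTS.
    exact: measurable_int iAB.
  - apply/measurable_EFinP; apply: measurable_funM.
      exact: measurableT_comp.
    by case: condB => mgB _ _; exact: measurableT_comp.
  - apply: filterS gAF => w e _; rewrite patchE /phi indicE e.
    have -> : (w \in X @^-1` C) = (X w \in C) by apply/idP/idP; rewrite !inE.
    by case: (X w \in C); rewrite ?mul1r ?mul0r.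
rewrite -(is_cond_exp_pull_out mX iB condB mphi phi01).
rewrite [RHS]integral_mkcond; apply: eq_integral => w _.
rewrite patchE /phi indicE /ind in_setI.
have -> : (w \in X @^-1` C) = (X w \in C) by apply/idP/idP; rewrite !inE.
by case: (X w \in C); case: (w \in _); rewrite ?mul1r ?mul0r ?mulr0 ?mulr1.
Qed.

Let Phi w : T * (R * R) := (X w, (Z w, Ut w)).
(** A copy of [Phi] with [Ut] replaced by the conditional quantile at an independent uniform
    coordinate. *)
Let Psi (z : R * Omega) : T * (R * R) := (X z.2, (Z z.2, quantile (F (X z.2)) z.1)).

Let mPhi : measurable_fun setT Phi.
Proof. by apply: measurable_fun_pair => //; exact: measurable_fun_pair. Qed.

Let mPsi : measurable_fun setT Psi.
Proof.
apply: measurable_fun_pair; first exact: (measurableT_comp mX measurable_snd).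
apply: measurable_fun_pair; first exact: (measurableT_comp mZ measurable_snd).
apply: (measurableT_comp (measurable_quantile ndF F0 F1 cF mF)
          (g := fun z : R * Omega => (z.1, X z.2))).
by apply: measurable_fun_pair => //; exact: (measurableT_comp mX measurable_snd).
Qed.

(** Two finite measures agreeing on an intersection-stable generator coincide. On a box, both sides
    are the integral of [F (X w) t]. *)
Lemma law_quantile_transform (A : set (T * (R * R))) : measurable A ->
  P (Phi @^-1` A) = (unif01 R \x P)%E (Psi @^-1` A).
Proof.
pose g n : set (T * (R * R)) := setT `*` (setT `*` `]-oo, n%:R]).
change (measurable A ->
  image_measure P mPhi A = image_measure (unif01 R \x P)%E mPsi A).
apply: (measure_unique _ g measurable_prod_prod_ray).
- move=> _ _ [C [B [t [mC mB ->]]]] [C' [B' [t' [mC' mB' ->]]]].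
  exists (C `&` C'), (B `&` B'), (Num.min t t'); split; [exact: measurableI..|].
  apply/seteqP; split => [[x [z s]]|[x [z s]]] /=; rewrite !in_itv/= le_min.
    by move=> [[? [? ->]] [? [? ->]]].
  by move=> [[? ?] [[? ?] /andP[]]].
- by move=> n; exists setT, setT, n%:R.
- apply/seteqP; split => // -[x [z t]] _; exists (Num.truncn `|t|).+1 => //.
  by rewrite /g/= in_itv/= (le_trans (ler_norm _))// ltW// truncnS_gt.
- move=> _ [C [B [t [mC mB ->]]]].
  transitivity (P (X @^-1` C `&` Z @^-1` B `&` Ut @^-1` `]-oo, t])).
    by congr (P _); apply/seteqP; split => [w [? []]|w [[]]].
  rewrite cond_indep_cdf//.
  (* The reversed product integrates the uniform coordinate first; it equals the product measure by
     uniqueness. *)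
  transitivity ((unif01 R \x^ P)%E (Psi @^-1` (C `*` (B `*` `]-oo, t])))).
    rewrite [RHS]/product_measure2/= integral_mkcond; apply: eq_integral => w _.
    rewrite patchE; case: ifPn => [|/negP] w_in.
      rewrite -(unif01_quantile_le ndF F0 F1 cF mF).
      move: w_in; rewrite inE => -[Cw Bw].
      congr (unif01 R _); apply/seteqP; split => u; rewrite /ysection/= !inE/= in_itv/=.
        by move=> qt; split.
      by move=> [_ []].
    rewrite (_ : ysection _ w = set0) ?measure0//.
    apply/seteqP; split => u //; rewrite /ysection/= !inE/= => -[Cw [Bw _]].
    by apply: w_in; rewrite inE.
  symmetry; apply: product_measure_unique => [A1 A2 mA1 mA2|].
    exact: product_measure2E.
  apply: measurable_preimage => //.
  by do 2 apply: measurableX => //; exact: measurable_itv.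
- move=> n; apply: (@le_lt_trans _ _ (1%:E)); last exact: ltry.
  apply: probability_le1; apply: (measurable_preimage mPhi).
  by do 2 apply: measurableX => //; exact: measurable_itv.
Qed.

(** The exceptional event has the probability of its counterpart under [Psi], which lies over the
    null set of [u] outside the open unit interval. *)
Lemma ae_quantile_transform (A : set (T * (R * R))) : measurable A ->
  (forall u w, 0 < u < 1 -> A (X w, (Z w, quantile (F (X w)) u))) ->
  {ae P, forall w, A (X w, (Z w, Ut w))}.
Proof.
move=> mA AQ; have mCA := measurableC mA.
exists (Phi @^-1` (~` A)); split => //; first exact: measurable_preimage.
rewrite law_quantile_transform//; apply/eqP; rewrite eq_le measure_ge0 andbT.
have [N [mN N0 sN]] := @unif01_ae R.
apply: (@le_trans _ _ ((unif01 R \x P)%E (N `*` setT))); last first.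
  by rewrite product_measure1E// [X in (X * _)%E]N0 mul0e.
apply: le_measure; rewrite ?inE; [exact: measurable_preimage|exact: measurableX|].
move=> [u w] nA; split => //=; apply: sN => /= u01; apply: nA; exact: AQ.
Qed.

(** On a flat piece of [F x] the quantile returns the left end, so this can fail pointwise. At [Ut]
    equal to a quantile it follows from [cdf_quantile]. *)
Lemma ae_quantile_cdfK : {ae P, forall w, quantile (F (X w)) (F (X w) (Ut w)) = Ut w}.
Proof.
pose q (y : T * (R * R)) := quantile (F y.1) (F y.1 y.2.2).
have mt : measurable_fun setT (fun y : T * (R * R) => y.2.2).
  exact: (measurableT_comp measurable_snd measurable_snd).
have mq : measurable_fun setT q.
  apply: (measurableT_comp (measurable_quantile ndF F0 F1 cF mF)
    (g := fun y : T * (R * R) => (F y.1 y.2.2, y.1))).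
  apply: measurable_fun_pair => //.
  apply: (measurableT_comp (measurable_cdf ndF F0 F1 cF mF)
    (g := fun y : T * (R * R) => (y.1, y.2.2))).
  exact: measurable_fun_pair.
pose A := [set y | q y <= y.2.2] `&` [set y | y.2.2 <= q y].
have mA : measurable A by apply: measurableI; exact: measurable_set_le.
have qK u w : 0 < u < 1 -> F (X w) (quantile (F (X w)) u) = u.
  exact: (cdf_quantile (ndF _) (F0 _) (F1 _) (cF _)).
have AQ u w : 0 < u < 1 -> A (X w, (Z w, quantile (F (X w)) u)).
  by move=> u01; split; rewrite /q/= qK.
apply: filterS (ae_quantile_transform A mA AQ) => w [/= qU Uq].
by apply/eqP; rewrite eq_le; apply/andP.
Qed.

(** When [Ut] is the quantile at [u], the right side compares [u] with [F] at the threshold, which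
    is [quantile_le]. *)
Lemma ae_le_cdf (m : T * R -> R) : measurable_fun setT m ->
  {ae P, forall w, (Ut w <= m (X w, Z w)) = (F (X w) (Ut w) <= F (X w) (m (X w, Z w)))}.
Proof.
move=> mm; pose m' (y : T * (R * R)) := m (y.1, y.2.1).
have mt : measurable_fun setT (fun y : T * (R * R) => y.2.2).
  exact: (measurableT_comp measurable_snd measurable_snd).
have mm' : measurable_fun setT m'.
  apply: (measurableT_comp mm (g := fun y : T * (R * R) => (y.1, y.2.1))).
  apply: measurable_fun_pair => //.
  exact: (measurableT_comp measurable_fst measurable_snd).
have mF' (k : T * (R * R) -> R) : measurable_fun setT k ->
    measurable_fun setT (fun y : T * (R * R) => F y.1 (k y)).
  move=> mk; apply: (measurableT_comp (measurable_cdf ndF F0 F1 cF mF)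
    (g := fun y : T * (R * R) => (y.1, k y))).
  exact: measurable_fun_pair.
pose b1 (y : T * (R * R)) := y.2.2 <= m' y.
pose b2 (y : T * (R * R)) := F y.1 y.2.2 <= F y.1 (m' y).
have mb1 : measurable_fun setT b1 by exact: measurable_fun_ler.
have mb2 : measurable_fun setT b2 by apply: measurable_fun_ler; exact: mF'.
(* Equality of the two booleans, written as a conditional so that its measurability is immediate. *)
pose b y := if b1 y then b2 y else ~~ b2 y.
have mb : measurable_fun setT b.
  by apply: measurable_fun_ifT => //; exact: measurable_neg.
have mA : measurable (b @^-1` [set true]) by exact: measurable_preimage.
have AQ u w : 0 < u < 1 ->
    (b @^-1` [set true]) (X w, (Z w, quantile (F (X w)) u)).
  move=> u01; rewrite /b /b1 /b2/= (cdf_quantile (ndF _) (F0 _) (F1 _) (cF _))//.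
  by rewrite (quantile_le (ndF _) (F0 _) (F1 _) (cF _))// /m'/=; case: ifP => ->.
apply: filterS (ae_quantile_transform _ mA AQ) => w; rewrite /b /b1 /b2 /m'/=.
by case: (Ut w <= _) => // /negbTE ->.
Qed.

Lemma integral_quantile_transform (f : T * (R * R) -> \bar R) :
  measurable_fun setT f -> P.-integrable setT (fun w => f (X w, (Z w, Ut w))) ->
  (\int[P]_w f (X w, (Z w, Ut w)) =
   \int[P]_w \int[unif01 R]_u f (X w, (Z w, quantile (F (X w)) u)))%E.
Proof.
move=> mf intf.
have law A : measurable A ->
    image_measure P mPhi A = image_measure (unif01 R \x P)%E mPsi A.
  exact: law_quantile_transform.
have mabs : measurable_fun setT (abse \o f) by exact: measurableT_comp.
(* Integrability depends only on the law of the triple, so it passes from [Phi] to [Psi]; Fubini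
   relies on it below. *)
have intPsi : (unif01 R \x P)%E.-integrable setT (f \o Psi).
  apply/integrableP; split; first exact: measurableT_comp.
  move/integrableP : intf => [_]; congr (_ < _)%E.
  transitivity (\int[image_measure P mPhi]_y `|f y|)%E.
    by rewrite (ge0_integral_pushforward mPhi)//.
  rewrite (eq_measure_integral (image_measure (unif01 R \x P)%E mPsi)).
    by rewrite (ge0_integral_pushforward mPsi)//.
  by move=> A mA _; exact: law.
transitivity (\int[image_measure P mPhi]_y f y)%E.
  by rewrite integral_image_measure.
rewrite (eq_measure_integral (image_measure (unif01 R \x P)%E mPsi)); last first.
  by move=> A mA _; exact: law.
rewrite integral_image_measure//= preimage_setT.
by rewrite -[LHS]integral21_prod_meas1.
Qed.

End ConditionalQuantileTransform.

(** * Thresholds and the marginal treatment effect *)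

Lemma is_cond_expB {d} {Omega : measurableType d} {R : realType}
  {P : probability Omega R} {dT} {T : measurableType dT}
  {V1 V2 : Omega -> R} {W : Omega -> T} {g1 g2 : T -> R} :
  measurable_fun setT W ->
  P.-integrable setT (EFin \o V1) -> P.-integrable setT (EFin \o V2) ->
  is_cond_exp P V1 W g1 -> is_cond_exp P V2 W g2 ->
  is_cond_exp P (fun w => V1 w - V2 w) W (fun x => g1 x - g2 x).
Proof.
move=> mW iV1 iV2 [mg1 ig1 g1E] [mg2 ig2 g2E]; split.
- exact: measurable_funB.
- have := integrableB measurableT ig1 ig2.
  by apply: eq_integrable.
- move=> S mS; have mWS := measurable_preimage mW mS.
  have intS (V : Omega -> R) : P.-integrable setT (EFin \o V) ->
      P.-integrable (W @^-1` S) (EFin \o V) by exact: integrableS.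
  under eq_integral do rewrite EFinB.
  under [RHS]eq_integral do rewrite EFinB.
  rewrite (integralB mWS (intS _ iV1) (intS _ iV2)).
  by rewrite (integralB mWS (intS _ ig1) (intS _ ig2)) g1E// g2E.
Qed.

Lemma integrable_mul_bounded {d} {Omega : measurableType d} {R : realType}
  {P : probability Omega R} {f k : Omega -> R} :
  P.-integrable setT (EFin \o f) -> measurable_fun setT k ->
  (forall w, `|k w| <= 1) -> P.-integrable setT (fun w => (f w * k w)%:E).
Proof.
move=> intf mk k1; apply: (le_integrable _ _ _ intf) => //.
  apply/measurable_EFinP; apply: measurable_funM => //.
  exact/measurable_EFinP/(measurable_int _ intf).
by move=> w _ /=; rewrite lee_fin normrM ler_piMr.
Qed.

(** Serves in both directions: to separate two treatment events, and to recombine them on the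
    uniform scale. *)
Lemma integral_mul_indB {d} {Omega : measurableType d} {R : realType}
  {P : probability Omega R} {V : Omega -> R} {a b : pred Omega} :
  P.-integrable setT (EFin \o V) ->
  measurable_fun setT a -> measurable_fun setT b ->
  (\int[P]_w (V w * ((a w)%:R - (b w)%:R))%:E =
   \int[P]_(w in [set w | a w]) (V w)%:E - \int[P]_(w in [set w | b w]) (V w)%:E)%E.
Proof.
move=> iV ma mb.
have mS (c : pred Omega) : measurable_fun setT c -> measurable [set w | c w].
  by move=> mc; rewrite -[X in measurable X]setTI; exact: (mc measurableT [set true]).
have iVS (c : pred Omega) : measurable_fun setT c ->
    P.-integrable setT ((EFin \o V) \_ [set w | c w]).
  move=> /mS mc; apply/(integrable_mkcond _ mc).1.
  exact: (integrableS measurableT).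
rewrite [X in (X - _)%E]integral_mkcond [X in (_ - X)%E]integral_mkcond.
rewrite -(integralB measurableT (iVS _ ma) (iVS _ mb)).
apply: eq_integral => w _; rewrite !patchE.
have inE' (c : pred Omega) : (w \in [set w | c w]) = c w by apply/idP/idP; rewrite inE.
rewrite !inE'; case: (a w); case: (b w) => /=.
- by rewrite subrr mulr0 -EFinB subrr.
- by rewrite subr0 mulr1 sube0.
- by rewrite sub0r mulrN1; exact/esym/add0e.
- by rewrite subrr mulr0 oppr0; exact/esym/add0e.
Qed.

Lemma measurable_fun_natr_bool {d} {T : measurableType d} {R : realType}
  {b : T -> bool} :
  measurable_fun setT b -> measurable_fun setT (fun x => (b x)%:R : R).
Proof.
move=> mb; rewrite (_ : (fun _ => _) = fun x => if b x then 1 else 0).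
  exact: measurable_fun_ifT.
by apply/funext => x; case: (b x).
Qed.

Lemma normr_natr_boolB {R : realType} (a b : bool) : `|a%:R - b%:R| <= 1 :> R.
Proof.
by case: a; case: b; rewrite ?subrr ?subr0 ?sub0r ?normrN ?normr0 ?normr1 ?ler01.
Qed.

Section MarginalTreatmentEffect.
Context {R : realType} {d} {Omega : measurableType d} {P : probability Omega R}.
Context {dT} {T : measurableType dT}.
Context {Ut Z : Omega -> R} {X : Omega -> T} {F : T -> R -> R}.
Hypothesis mUt : measurable_fun setT Ut.
Hypothesis mZ : measurable_fun setT Z.
Hypothesis mX : measurable_fun setT X.
Hypothesis UZ : cond_indep P Ut Z X.
Hypothesis FX : is_cond_cdf P Ut X F.
Hypothesis cF : forall x, continuous (F x).
Context {V : Omega -> R} {g : R * T -> R} {h : T * R -> R}.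
Hypothesis iV : P.-integrable setT (EFin \o V).
Hypothesis gV : is_cond_exp P V (fun w => (normU F X Ut w, X w)) g.

Let ndF : forall x, {homo F x : s t / s <= t}. Proof. by case: FX. Qed.
Let F0 : forall x, F x t @[t --> -oo] --> (0 : R). Proof. by case: FX. Qed.
Let F1 : forall x, F x t @[t --> +oo] --> (1 : R). Proof. by case: FX. Qed.
Let mF : forall t, measurable_fun setT (F ^~ t).
Proof. by move=> t; case: FX => _ _ _ _ /(_ t)[]. Qed.

Let measurable_cdf_comp {d'} {S : measurableType d'} {f : S -> T} {k : S -> R} :
  measurable_fun setT f -> measurable_fun setT k ->
  measurable_fun setT (fun s => F (f s) (k s)).
Proof.
move=> mf mk; apply: (measurableT_comp (measurable_cdf ndF F0 F1 cF mF)
  (g := fun s => (f s, k s))).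
exact: measurable_fun_pair.
Qed.

(* [Ut] is almost surely a function of [(F X Ut, X)], so that conditioning on
   [(X, Ut)] gives nothing more than conditioning on [(F X Ut, X)]. *)
Lemma is_cond_exp_normU :
  is_cond_exp P V (fun w => (X w, Ut w)) (fun q => g (F q.1 q.2, q.1)).
Proof.
have [mg ig gE] := gV; split => //.
  apply: (measurableT_comp mg (g := fun q : T * R => (F q.1 q.2, q.1))).
  by apply: measurable_fun_pair => //; exact: measurable_cdf_comp.
move=> S mS.
(* Since [Ut] is almost surely the quantile at [normU], the event [S] for the pair of [X] and [Ut]
   is an event for the pair of [normU] and [X]. *)
pose Sq : set (R * T) := [set y | S (y.2, quantile (F y.2) y.1)].
have mSq : measurable Sq.
  apply: (measurable_preimage (f := fun y : R * T => (y.2, quantile (F y.2) y.1))) => //.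
  apply: measurable_fun_pair => //.
  exact: (measurable_quantile ndF F0 F1 cF mF).
have mXU : measurable_fun setT (fun w => (X w, Ut w)) by exact: measurable_fun_pair.
have mUX : measurable_fun setT (fun w => (normU F X Ut w, X w)).
  by apply: measurable_fun_pair => //; exact: measurable_cdf_comp.
have SqE : {ae P, forall w, ((fun w => (X w, Ut w)) @^-1` S) w <->
    ((fun w => (normU F X Ut w, X w)) @^-1` Sq) w}.
  apply: filterS (ae_quantile_cdfK mUt mZ mX UZ FX cF) => w.
  by rewrite /Sq /= /normU => ->.
have mSXU := measurable_preimage mXU mS.
have mSUX := measurable_preimage mUX mSq.
rewrite (integral_ae_eq_set mSXU mSUX (measurable_int _ iV) SqE).
rewrite gE//; symmetry.
exact: (integral_ae_eq_set mSXU mSUX (measurable_int _ ig) SqE).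
Qed.

Hypothesis hV : is_cond_exp P V (fun w => (X w, Ut w)) h.
Hypothesis hVZ : is_cond_exp P V (fun w => (X w, (Z w, Ut w)))
  (fun q : T * (R * R) => h (q.1, q.2.2)).

(** The event depends on [Z], so conditioning is on [X], [Z] and [Ut]; mean independence makes the
    result [h], free of [Z]. Almost surely [h] is [g] by [is_cond_exp_normU], and [ae_le_cdf]
    rescales the event. *)
Lemma integral_below_threshold (m : T * R -> R) : measurable_fun setT m ->
  (\int[P]_(w in [set w | (Ut w <= m (X w, Z w))%R]) (V w)%:E =
   \int[P]_(w in [set w | (normU F X Ut w <= F (X w) (m (X w, Z w)))%R])
     (g (normU F X Ut w, X w))%:E)%E.
Proof.
move=> mm; have [mh ih hE] := hVZ; have [mg ig _] := gV.
have mXU : measurable_fun setT (fun w => (X w, Ut w)) by exact: measurable_fun_pair.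
have mmXZ : measurable_fun setT (fun w => m (X w, Z w)).
  by apply: (measurableT_comp mm); exact: measurable_fun_pair.
pose S : set (T * (R * R)) := [set y | y.2.2 <= m (y.1, y.2.1)].
have mS : measurable S.
  apply: measurable_set_le; first exact: (measurableT_comp measurable_snd measurable_snd).
  apply: (measurableT_comp mm (g := fun y : T * (R * R) => (y.1, y.2.1))).
  apply: measurable_fun_pair => //.
  exact: (measurableT_comp measurable_fst measurable_snd).
rewrite [LHS](hE S mS).
have mA : measurable [set w | Ut w <= m (X w, Z w)] by exact: measurable_set_le.
rewrite (@ae_eq_integral _ _ _ _ _ (fun w => (g (normU F X Ut w, X w))%:E))//.
- apply: integral_ae_eq_set => //.
  + by apply: measurable_set_le => //; exact: measurable_cdf_comp.
  + exact: measurable_int ig.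
  + apply: filterS (ae_le_cdf mUt mZ mX UZ FX cF m mm) => w /= e.
    by rewrite /S /= e.
- exact/measurable_funTS/(measurable_int _ ih).
- exact/measurable_funTS/(measurable_int _ ig).
- apply: filterS (is_cond_exp_unique mXU hV is_cond_exp_normU) => w /= -> _.
  by [].
Qed.

Lemma integral_threshold_difference (m0 m1 : T * R -> R) :
  measurable_fun setT m0 -> measurable_fun setT m1 ->
  (\int[P]_w (V w * ((Ut w <= m1 (X w, Z w))%R%:R - (Ut w <= m0 (X w, Z w))%R%:R))%:E =
   \int[P]_w (\int[@lebesgue_measure R]_(u in `[0%R, 1%R])
     (g (u, X w) * (((u : R) <= F (X w) (m1 (X w, Z w)))%R%:R -
                    ((u : R) <= F (X w) (m0 (X w, Z w)))%R%:R))%:E))%E.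
Proof.
move=> mm0 mm1; have [mg ig _] := gV.
have mXZ : measurable_fun setT (fun w => (X w, Z w)) by exact: measurable_fun_pair.
have mU : measurable_fun setT (normU F X Ut) by exact: measurable_cdf_comp.
have mFm m : measurable_fun setT m -> measurable_fun setT (fun w => F (X w) (m (X w, Z w))).
  by move=> mm; apply: measurable_cdf_comp => //; exact: (measurableT_comp mm mXZ).
rewrite integral_mul_indB//; last 2 first.
- by apply: measurable_fun_ler => //; exact: (measurableT_comp mm1 mXZ).
- by apply: measurable_fun_ler => //; exact: (measurableT_comp mm0 mXZ).
rewrite !integral_below_threshold//.
rewrite -integral_mul_indB//; last 2 first.
- by apply: measurable_fun_ler => //; exact: mFm.
- by apply: measurable_fun_ler => //; exact: mFm.
pose K (y : R * (T * R)) : R :=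
  g (y.1, y.2.1) * ((y.1 <= F y.2.1 (m1 y.2))%R%:R - (y.1 <= F y.2.1 (m0 y.2))%R%:R).
have mK : measurable_fun setT K.
  have m21 : measurable_fun setT (fun y : R * (T * R) => y.2.1).
    exact: (measurableT_comp measurable_fst measurable_snd).
  have mle m : measurable_fun setT m ->
      measurable_fun setT (fun y : R * (T * R) => y.1 <= F y.2.1 (m y.2)).
    move=> mm; apply: measurable_fun_ler => //.
    by apply: measurable_cdf_comp => //; exact: (measurableT_comp mm measurable_snd).
  apply: measurable_funM.
    by apply: (measurableT_comp mg); exact: measurable_fun_pair.
  by apply: measurable_funB; apply: measurable_fun_natr_bool; exact: mle.
(* Change to the uniform scale: the triple [x], [z], [t] becomes [F x t], [x], [z], the arguments of
   [K]. *)
pose c (y : T * (R * R)) : R * (T * R) := (F y.1 y.2.2, (y.1, y.2.1)).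
have mc : measurable_fun setT c.
  have m22 : measurable_fun setT (fun y : T * (R * R) => y.2.2).
    exact: (measurableT_comp measurable_snd measurable_snd).
  apply: measurable_fun_pair; first exact: measurable_cdf_comp.
  apply: measurable_fun_pair => //.
  exact: (measurableT_comp measurable_fst measurable_snd).
have mKc : measurable_fun setT (fun y => (K (c y))%:E).
  by apply/measurable_EFinP; exact: measurableT_comp.
have iK : P.-integrable setT (fun w => (K (c (X w, (Z w, Ut w))))%:E).
  apply: (integrable_mul_bounded ig).
    apply: measurable_funB; apply: measurable_fun_natr_bool.
    - by apply: measurable_fun_ler => //; exact: mFm.
    - by apply: measurable_fun_ler => //; exact: mFm.
  by move=> w; exact: normr_natr_boolB.
rewrite [LHS](integral_quantile_transform mUt mZ mX UZ FX cF _ mKc iK).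
apply: eq_integral => w _.
have mKw : measurable_fun setT (fun u : R => (K (u, (X w, Z w)))%:E).
  by apply/measurable_EFinP; apply: (measurableT_comp mK); exact: measurable_pair2.
rewrite -(integral_unif01 _ (fun u => (K (u, (X w, Z w)))%:E)) //.
(* For [u] inside the unit interval, [F] undoes the quantile, so the transformed integrand is [K] at
   [u] itself. *)
apply: ae_eq_integral => //.
  apply: (measurableT_comp mKc (g := fun u => (X w, (Z w, quantile (F (X w)) u)))).
  apply: measurable_fun_pair => //; apply: measurable_fun_pair => //.
  apply: (measurableT_comp (measurable_quantile ndF F0 F1 cF mF)
    (g := fun u => (u, X w))).
  exact: measurable_fun_pair.
apply: filterS (unif01_ae R) => u u01 _.
by rewrite /c/= (cdf_quantile (ndF _) (F0 _) (F1 _) (cF _)).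
Qed.

End MarginalTreatmentEffect.

Theorem theorem1 (R : realType) (d : measure_display) (Omega : measurableType d)
  (P : probability Omega R) (dx : nat)
  (Y0 Y1 Ut Z : Omega -> R) (X : Omega -> covspace R dx)
  (nut : (covspace R dx * R)%type -> R)
  (F : covspace R dx -> R -> R)
  (MTE : (R * covspace R dx)%type -> R)
  (alpha : (covspace R dx * R)%type -> R) :
  measurable_fun setT Y0 -> measurable_fun setT Y1 ->
  measurable_fun setT Ut -> measurable_fun setT Z -> measurable_fun setT X ->
  measurable_fun setT nut ->
  (* Assumption 1 (i) *)
  cond_indep P Ut Z X ->
  (* Assumption 1 (ii) *)
  mean_indep P Y0 X Z Ut -> mean_indep P Y1 X Z Ut ->
  P.-integrable setT (EFin \o Y0) -> P.-integrable setT (EFin \o Y1) ->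
  (* Assumption 1 (iii): F is the conditional CDF of U~ given X, continuous *)
  is_cond_cdf P Ut X F -> (forall x, continuous (F x)) ->
  (* MTE(u,x) = E[Y(1) - Y(0) | U = u, X = x] *)
  is_cond_exp P (fun w => Y1 w - Y0 w) (fun w => (normU F X Ut w, X w)) MTE ->
  (* the encouragement rule *)
  measurable_fun setT alpha ->
  let D := fun a w => Dpot nut X Ut a w in
  let Y := fun w => Ypot Y0 Y1 (D (Z w) w) w in
  let p := pscore F nut in
  (\int[P]_w (Ypot Y0 Y1 (D (alpha (X w, Z w)) w) w)%:E =
   \int[P]_w (Y w)%:E +
   \int[P]_w (\int[@lebesgue_measure R]_(u in `[0%R, 1%R]) 
       (MTE (u, X w) *
        (((u : R) <= p (X w) (alpha (X w, Z w)))%R%:R - ((u : R) <= p (X w) (Z w))%R%:R))%:E))%E.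
Proof.
move=> mY0 mY1 mUt mZ mX mnut UZ [h0 [h0V h0VZ]] [h1 [h1V h1VZ]] iY0 iY1 FX cF gV.
move=> malpha D Y p.
(* The rule's threshold for [Ut] is a function of [X] and [Z], as is the status quo threshold
   [nut]. *)
pose ma (q : covspace R dx * R) : R := nut (q.1, alpha q).
have mma : measurable_fun setT ma.
  apply: (measurableT_comp mnut (g := fun q => (q.1, alpha q))).
  exact: measurable_fun_pair.
have mXZ : measurable_fun setT (fun w => (X w, Z w)) by exact: measurable_fun_pair.
have mXUt : measurable_fun setT (fun w => (X w, Ut w)) by exact: measurable_fun_pair.
have mXZUt : measurable_fun setT (fun w => (X w, (Z w, Ut w))).
  by apply: measurable_fun_pair => //; exact: measurable_fun_pair.
have iV : P.-integrable setT (EFin \o (fun w => Y1 w - Y0 w)).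
  have := integrableB measurableT iY1 iY0.
  by apply: eq_integrable.
have hV := is_cond_expB mXUt iY1 iY0 h1V h0V.
have hVZ := is_cond_expB mXZUt iY1 iY0 h1VZ h0VZ.
rewrite -[X in (_ + X)%E](integral_threshold_difference
  mUt mZ mX UZ FX cF iV gV hV hVZ nut ma mnut mma).
pose b0 w : R := (Ut w <= nut (X w, Z w))%R%:R.
pose b1 w : R := (Ut w <= ma (X w, Z w))%R%:R.
have mb0 : measurable_fun setT b0.
  apply: measurable_fun_natr_bool; apply: measurable_fun_ler => //.
  exact: (measurableT_comp mnut mXZ).
have mb1 : measurable_fun setT b1.
  apply: measurable_fun_natr_bool; apply: measurable_fun_ler => //.
  exact: (measurableT_comp mma mXZ).
(* Writing the outcome as [Y0] plus gain times treatment yields its integrability and reduces the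
   welfare change to a difference of two threshold events. *)
have YE w : Y w = Y0 w + (Y1 w - Y0 w) * b0 w.
  by rewrite /Y /Ypot /D /Dpot subr_ge0 -/(b0 w); ring.
have iVb0 : P.-integrable setT (fun w => ((Y1 w - Y0 w) * b0 w)%:E).
  apply: (integrable_mul_bounded iV mb0) => w; rewrite -[b0 w]subr0.
  exact: (normr_natr_boolB _ false).
have iVb : P.-integrable setT (fun w => ((Y1 w - Y0 w) * (b1 w - b0 w))%:E).
  apply: (integrable_mul_bounded iV); first exact: measurable_funB.
  by move=> w; exact: normr_natr_boolB.
have iY : P.-integrable setT (fun w => (Y w)%:E).
  have := integrableD measurableT iY0 iVb0.
  by apply: eq_integrable => // w _; rewrite YE.
rewrite -(integralD measurableT iY iVb).
apply: eq_integral => w _; rewrite -EFinD YE; congr EFin.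
by rewrite /Ypot /D /Dpot subr_ge0 -/(b0 w) -/(b1 w); ring.
Qed.
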